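(* There exist $2^{\mathfrak{c}}$ pairwise non-homeomorphic topologies $\tau\in\mathcal{L}$ such that $(\mathbb{R},\tau)$ is a Baire space which is not regular.
   Context: $\mathfrak{c}=|\mathbb{R}|$. $\eta$ denotes the Euclidean topology on $\mathbb{R}$. $\mathcal{L}$ denotes the family of all Hausdorff topologies $\tau$ on the set $\mathbb{R}$ with $\tau\subset\eta$. *)

(* Defs.v *)
From Stdlib Require Import Reals.
Open Scope R_scope.

Definition subsetR := R -> Prop.
Definition topR := subsetR -> Prop.

Definition eta : topR := fun U =>
  forall x, U x -> exists eps, 0 < eps /\ forall y, Rabs (y - x) < eps -> U y.

Definition is_topology (tau : topR) : Prop :=
  tau (fun _ => True) /\
  tau (fun _ => False) /\
  (forall U V, tau U -> tau V -> tau (fun x => U x /\ V x)) /\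
  (forall F : subsetR -> Prop, (forall U, F U -> tau U) ->
     tau (fun x => exists U, F U /\ U x)).

Definition hausdorff (tau : topR) : Prop :=
  forall x y, x <> y -> exists U V, tau U /\ tau V /\ U x /\ V y /\
    forall z, ~ (U z /\ V z).

Definition in_L (tau : topR) : Prop :=
  is_topology tau /\ hausdorff tau /\ (forall U, tau U -> eta U).

Definition closed_in (tau : topR) (C : subsetR) : Prop :=
  tau (fun x => ~ C x).

Definition regular (tau : topR) : Prop :=
  forall (C : subsetR) x, closed_in tau C -> ~ C x ->
    exists U V, tau U /\ tau V /\ U x /\ (forall y, C y -> V y) /\
      forall z, ~ (U z /\ V z).

Definition dense_in (tau : topR) (D : subsetR) : Prop :=
  forall U, tau U -> (exists x, U x) -> exists x, U x /\ D x.

Definition baire (tau : topR) : Prop :=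
  forall G : nat -> subsetR, (forall n, tau (G n) /\ dense_in tau (G n)) ->
    dense_in tau (fun x => forall n, G n x).

Definition homeomorphic (tau1 tau2 : topR) : Prop :=
  exists (f g : R -> R),
    (forall x, g (f x) = x) /\ (forall y, f (g y) = y) /\
    (forall V, tau2 V -> tau1 (fun x => V (f x))) /\
    (forall U, tau1 U -> tau2 (fun y => U (g y))).

(* Main.v *)
(** Weaken the Euclidean topology at the single point 0: for a nonempty set [A]
    of reals in [0, 1/2], a Euclidean open [U] containing 0 is declared open only
    if for every [x] in [A] it contains almost all of the strips
    ]n+1+x, n+1+x+w_n[, where w_n decreases to 0.  The left endpoints of the
    strips at one [x] in [A] form a closed set that cannot be separated from 0.
    Only neighbourhoods of 0 change, so the usual nested-interval argument away
    from 0 gives the Baire property.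

    All these topologies lie between a fixed Hausdorff topology and the
    Euclidean one, so a homeomorphism between two of them is determined by its
    values on the rationals and is coded by one real number.  A diagonal argument
    in the style of König, applied to index sets of the form R -> P(R), then
    produces 2^c of them that are pairwise non-homeomorphic, without any cardinal
    arithmetic. *)

Require Import Defs.
From Stdlib Require Import Reals.
From Stdlib Require Import Lra Lia Cantor Classical ClassicalEpsilon.
From Stdlib Require Import FunctionalExtensionality PropExtensionality.

(** * Choice, extensionality and Euclidean open sets *)

Lemma choice (A B : Type) (P : A -> B -> Prop) :
  (forall a, exists b, P a b) -> exists f : A -> B, forall a, P a (f a).
Proof.
  intros H.
  exists (fun a => proj1_sig (constructive_indefinite_description _ (H a))).
  intros a. apply proj2_sig.
Qed.

Lemma subset_ext (A B : subsetR) : (forall x, A x <-> B x) -> A = B.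
Proof.
  intros H. apply functional_extensionality. intros x.
  apply propositional_extensionality, H.
Qed.

Lemma eta_inter (U V : subsetR) : eta U -> eta V -> eta (fun x => U x /\ V x).
Proof.
  intros HU HV x [Ux Vx].
  destruct (HU x Ux) as [d [d0 Hd]]. destruct (HV x Vx) as [e [e0 He]].
  exists (Rmin d e). split.
  - now apply Rmin_glb_lt.
  - intros y Hy. pose proof (Rmin_l d e). pose proof (Rmin_r d e).
    split; [apply Hd | apply He]; lra.
Qed.

Lemma eta_interval (a b : R) : eta (fun z => a < z < b).
Proof.
  intros x [Ha Hb]. exists (Rmin (x - a) (b - x)). split.
  - apply Rmin_glb_lt; lra.
  - intros y Hy. pose proof (Rmin_l (x - a) (b - x)).
    pose proof (Rmin_r (x - a) (b - x)). apply Rabs_def2 in Hy. lra.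
Qed.

Lemma eta_ball (c r : R) : eta (fun z => Rabs (z - c) < r).
Proof.
  intros x Hx. exists (r - Rabs (x - c)). split; [lra |].
  intros y Hy. replace (y - c) with ((y - x) + (x - c)) by ring.
  pose proof (Rabs_triang (y - x) (x - c)). lra.
Qed.

Lemma eta_ball_exterior (c r : R) : eta (fun z => r < Rabs (z - c)).
Proof.
  intros x Hx. exists (Rabs (x - c) - r). split; [lra |].
  intros y Hy. pose proof (Rabs_triang (x - y) (y - c)) as H.
  replace (x - y + (y - c)) with (x - c) in H by ring.
  rewrite (Rabs_minus_sym x y) in H. lra.
Qed.

Lemma exists_INR_ge (r : R) : exists N, forall n, (N <= n)%nat -> r < INR n.
Proof.
  destruct (INR_unbounded r) as [N HN]. exists N. intros n Hn.
  apply le_INR in Hn. lra.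
Qed.

(** The lower bound lets only finitely many terms come near a given point, so the least distance to
    those terms is positive. *)
Lemma eta_sequence_complement (p : nat -> R) :
  (forall n, INR n <= p n) -> eta (fun z => forall n, z <> p n).
Proof.
  intros Hp z Hz.
  assert (Hfin : forall N, exists d, 0 < d /\
            forall n, (n < N)%nat -> d <= Rabs (p n - z)).
  { induction N as [|N [d [d0 Hd]]].
    - exists 1. split; [lra | lia].
    - exists (Rmin d (Rabs (p N - z))). split.
      + apply Rmin_glb_lt; [assumption |]. apply Rabs_pos_lt.
        specialize (Hz N). lra.
      + intros n Hn. destruct (Nat.eq_dec n N) as [-> | HnN].
        * apply Rmin_r.
        * apply Rle_trans with d; [apply Rmin_l | apply Hd; lia]. }
  destruct (exists_INR_ge (z + 1)) as [N HN].
  destruct (Hfin N) as [d [d0 Hd]].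
  exists (Rmin d 1). split; [apply Rmin_glb_lt; lra |].
  intros y Hy n ->. pose proof (Rmin_l d 1). pose proof (Rmin_r d 1).
  destruct (Nat.lt_ge_cases n N) as [Hn | Hn].
  - specialize (Hd n Hn). lra.
  - specialize (HN n Hn). specialize (Hp n). apply Rabs_def2 in Hy. lra.
Qed.

(** * The strip topologies and their membership in $\mathcal{L}$ *)

(** The summand 4 keeps widths at most 1/4, so for an offset in [0, 1/2] the strip at level n ends
    before n + 2. *)
Definition width (n : nat) : R := / (INR n + 4).

Lemma width_pos (n : nat) : 0 < width n.
Proof. apply Rinv_0_lt_compat. pose proof (pos_INR n). lra. Qed.

Lemma width_le (n : nat) : width n <= / 4.
Proof. apply Rinv_le_contravar; [| pose proof (pos_INR n)]; lra. Qed.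

Lemma width_small (e : R) :
  0 < e -> exists N, forall n, (N <= n)%nat -> width n < e.
Proof.
  intros He. destruct (exists_INR_ge (/ e)) as [N HN]. exists N.
  intros n Hn. specialize (HN n Hn). unfold width.
  rewrite <- (Rinv_inv e). apply Rinv_lt_contravar; [| lra].
  pose proof (Rinv_0_lt_compat e He). apply Rmult_lt_0_compat; lra.
Qed.

Definition strip (x : R) (n : nat) : subsetR :=
  fun z => INR n + 1 + x < z < INR n + 1 + x + width n.

Definition strip_topology (A : subsetR) : topR := fun U =>
  eta U /\
  (U 0 -> forall x, A x ->
     exists N, forall n, (N <= n)%nat -> forall z, strip x n z -> U z).

Lemma strip_topology_antimono (A B : subsetR) (U : subsetR) :
  (forall x, A x -> B x) -> strip_topology B U -> strip_topology A U.
Proof.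
  intros HAB [HU HB]. split; [assumption |]. intros U0 x Ax.
  now apply HB; [| apply HAB].
Qed.

Lemma strip_topology_missing_0 (A U : subsetR) :
  eta U -> ~ U 0 -> strip_topology A U.
Proof. intros HU H0. now split. Qed.

Lemma strip_topology_is_topology (A : subsetR) : is_topology (strip_topology A).
Proof.
  split; [| split; [| split]].
  - split.
    + intros x _. exists 1. split; [lra | trivial].
    + intros _ x _. now exists 0%nat.
  - now split.
  - intros U V [HU HU0] [HV HV0]. split; [now apply eta_inter |].
    intros [U0 V0] x Ax.
    destruct (HU0 U0 x Ax) as [N HN]. destruct (HV0 V0 x Ax) as [M HM].
    exists (Nat.max N M). intros n Hn z Hz.
    split; [apply (HN n) | apply (HM n)]; auto; lia.
  - intros F HF. split.
    + intros x [U [FU Ux]]. destruct (HF U FU) as [HU _].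
      destruct (HU x Ux) as [e [e0 He]]. exists e. split; [assumption |].
      intros y Hy. exists U. auto.
    + intros [U [FU U0]] x Ax. destruct (HF U FU) as [_ HU].
      destruct (HU U0 x Ax) as [N HN]. exists N. intros n Hn z Hz.
      exists U. split; [assumption |]. now apply (HN n).
Qed.

(** This is the coarsest strip topology, so all others inherit the property. One of the two points
    is nonzero: a small ball around it misses 0, and the exterior of that ball contains every far
    strip. *)
Lemma strip_topology_full_hausdorff : hausdorff (strip_topology (fun _ => True)).
Proof.
  assert (H : forall x y, x <> y -> y <> 0 ->
    exists U V, strip_topology (fun _ => True) U /\
      strip_topology (fun _ => True) V /\ U x /\ V y /\ forall z, ~ (U z /\ V z)).
  { intros x y Hxy Hy.
    (* [d < Rabs y] keeps 0 out of the ball, and [d < Rabs (x - y)] puts [x] in the exterior. *)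
    set (d := Rmin (Rabs y) (Rabs (x - y)) / 2).
    assert (Hpos : 0 < Rmin (Rabs y) (Rabs (x - y))).
    { apply Rmin_glb_lt; apply Rabs_pos_lt; lra. }
    pose proof (Rmin_l (Rabs y) (Rabs (x - y))) as H1.
    pose proof (Rmin_r (Rabs y) (Rabs (x - y))) as H2.
    exists (fun z => d < Rabs (z - y)), (fun z => Rabs (z - y) < d).
    split; [| split; [| split; [| split]]].
    - split; [apply eta_ball_exterior |]. intros _ t _.
      destruct (exists_INR_ge (y + d - t)) as [N HN]. exists N.
      intros n Hn z [Hz _]. specialize (HN n Hn).
      apply Rlt_le_trans with (z - y); [lra | apply Rle_abs].
    - apply strip_topology_missing_0; [apply eta_ball |].
      rewrite Rminus_0_l, Rabs_Ropp. unfold d. lra.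
    - unfold d. lra.
    - rewrite Rminus_diag, Rabs_R0. unfold d. lra.
    - intros z. lra. }
  intros x y Hxy. destruct (Req_dec y 0) as [Hy | Hy].
  - destruct (H y x) as (U & V & HU & HV & Uy & Vx & HUV); [lra | lra |].
    exists V, U. repeat split; try assumption; try apply HU; try apply HV.
    intros z [Hz1 Hz2]. now apply (HUV z).
  - now apply H.
Qed.

Lemma strip_topology_in_L (A : subsetR) : in_L (strip_topology A).
Proof.
  split; [apply strip_topology_is_topology | split].
  - intros x y Hxy.
    destruct (strip_topology_full_hausdorff x y Hxy) as (U & V & HU & HV & H).
    exists U, V. split; [| split; [| exact H]];
      now apply (strip_topology_antimono A (fun _ => True)).
  - now intros U [HU _].
Qed.

(** * The Baire property *)

Lemma eta_closed_subinterval (U : subsetR) (x : R) :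
  eta U -> U x -> exists a b, a < b /\ forall z, a <= z <= b -> U z.
Proof.
  intros HU Ux. destruct (HU x Ux) as [e [e0 He]].
  exists (x - e / 2), (x + e / 2). split; [lra |].
  intros z Hz. apply He, Rabs_def1; lra.
Qed.

Lemma nested_intervals (a b : nat -> R) :
  (forall n, a n <= b n) -> (forall n, a n <= a (S n)) ->
  (forall n, b (S n) <= b n) -> exists x, forall n, a n <= x <= b n.
Proof.
  intros Hab Ha Hb.
  assert (Ha' : forall n k, a n <= a (n + k)%nat).
  { intros n. induction k as [|k IH].
    - rewrite Nat.add_0_r. lra.
    - rewrite Nat.add_succ_r. specialize (Ha (n + k)%nat). lra. }
  assert (Hb' : forall n k, b (n + k)%nat <= b n).
  { intros n. induction k as [|k IH].
    - rewrite Nat.add_0_r. lra.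
    - rewrite Nat.add_succ_r. specialize (Hb (n + k)%nat). lra. }
  assert (Hle : forall n m, a n <= b m).
  { intros n m. specialize (Ha' n m). specialize (Hb' m n).
    rewrite (Nat.add_comm m n) in Hb'. specialize (Hab (n + m)%nat). lra. }
  destruct (completeness (fun r => exists n, r = a n)) as [x [Hub Hlub]].
  - exists (b 0%nat). intros r [n ->]. apply Hle.
  - exists (a 0%nat). now exists 0%nat.
  - exists x. intros n. split.
    + apply Hub. now exists n.
    + apply Hlub. intros r [m ->]. apply Hle.
Qed.

Lemma strip_topology_baire (A : subsetR) : baire (strip_topology A).
Proof.
  intros G HG U [HU _] [x0 Ux0].
  set (good := fun p : R * R => fst p < snd p /\ ~ (fst p <= 0 <= snd p)).
  (* [good] intervals avoid 0, so their interiors are open in the strip topology and density applies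
     to them. Goodness is assumed inside the existential to make [step] total. *)
  assert (Hstep : forall np : nat * (R * R), exists q : R * R, good (snd np) ->
    good q /\ fst (snd np) <= fst q /\ snd q <= snd (snd np) /\
    forall z, fst q <= z <= snd q -> G (fst np) z).
  { intros [n [a b]]. destruct (classic (good (a, b))) as [Hg | Hg];
      [| now exists (a, b)].
    destruct (Hg) as [Hab H0]. simpl in *.
    destruct (HG n) as [[HGn _] Hd].
    destruct (Hd (fun z => a < z < b)) as [y [Hy Gy]].
    - apply strip_topology_missing_0; [apply eta_interval | lra].
    - exists ((a + b) / 2). lra.
    - destruct (eta_closed_subinterval (fun z => (a < z < b) /\ G n z) y)
        as [c [d [Hcd H]]]; [apply eta_inter; [apply eta_interval | assumption] | tauto |].
      exists (c, d). intros _. unfold good. simpl.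
      destruct (H c) as [Hc _]; [lra |]. destruct (H d) as [Hd' _]; [lra |].
      repeat split; try lra. intros z Hz. now apply H. }
  destruct (choice _ _ _ Hstep) as [step Hstep'].
  (* An interval around 0 is shrunk to one side of 0. *)
  assert (Hinit : exists p, good p /\ forall z, fst p <= z <= snd p -> U z).
  { destruct (eta_closed_subinterval U x0 HU Ux0) as [a [b [Hab HabU]]].
    destruct (Rlt_le_dec b 0) as [Hb | Hb].
    - exists (a, b). unfold good; simpl. split; [lra | assumption].
    - destruct (Rlt_le_dec 0 b) as [Hb' | Hb'].
      + pose proof (Rmax_l a 0). pose proof (Rmax_r a 0).
        assert (Rmax a 0 < b) by now apply Rmax_lub_lt.
        exists ((Rmax a 0 + b) / 2, b). unfold good; simpl. split; [lra |].
        intros z Hz. apply HabU. lra.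
      + exists (a, (a + b) / 2). unfold good; simpl. split; [lra |].
        intros z Hz. apply HabU. lra. }
  destruct Hinit as [p0 [Hp0 Hp0U]].
  set (p := fix p n := match n with O => p0 | S n => step (n, p n) end).
  assert (Hp : forall n, good (p n)).
  { induction n as [|n IH]; [exact Hp0 |]. now apply (Hstep' (n, p n)). }
  destruct (nested_intervals (fun n => fst (p n)) (fun n => snd (p n))) as [x Hx].
  - intros n. destruct (Hp n). lra.
  - intros n. now apply (Hstep' (n, p n) (Hp n)).
  - intros n. now apply (Hstep' (n, p n) (Hp n)).
  - exists x. split.
    + apply Hp0U, (Hx 0%nat).
    + intros n. apply (Hstep' (n, p n) (Hp n)), (Hx (S n)).
Qed.

(** * Failure of regularity, and recovery of the index set *)

Definition below_half (A : subsetR) : Prop := forall x, A x -> 0 <= x <= / 2.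

(** Different levels never meet, since strips at level m stay within [m + 1, m + 7/4]. On one level,
    strips at distinct offsets separate once the width is below [Rabs (x - y)]. The closed strip at
    [x] covers both endpoints and midpoints. *)
Lemma strip_disjoint (x y : R) :
  0 <= x <= / 2 -> 0 <= y <= / 2 ->
  exists N, forall n, (N <= n)%nat -> forall m z, x <> y \/ m <> n ->
    INR m + 1 + x <= z <= INR m + 1 + x + width m -> ~ strip y n z.
Proof.
  intros Hx Hy.
  assert (HN : exists N, forall n, (N <= n)%nat -> x <> y -> width n < Rabs (x - y)).
  { destruct (Req_dec x y) as [-> | Hxy].
    - exists 0%nat. tauto.
    - destruct (width_small (Rabs (x - y))) as [N HN].
      + apply Rabs_pos_lt. lra.
      + exists N. auto. }
  destruct HN as [N HN]. exists N. intros n Hn m z Hmn Hz [Hz1 Hz2].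
  pose proof (width_le n). pose proof (width_le m).
  destruct (Nat.lt_total m n) as [Hlt | [-> | Hlt]].
  - apply le_INR in Hlt. rewrite S_INR in Hlt. lra.
  - destruct Hmn as [Hxy | ]; [| tauto]. specialize (HN n Hn Hxy).
    unfold Rabs in HN. destruct (Rcase_abs (x - y)); lra.
  - apply le_INR in Hlt. rewrite S_INR in Hlt. lra.
Qed.

Lemma strip_topology_not_regular (A : subsetR) (x : R) :
  below_half A -> A x -> ~ regular (strip_topology A).
Proof.
  intros HA Ax Hreg. pose proof (HA x Ax) as Hx.
  destruct (Hreg (fun z => exists n, z = INR n + 1 + x) 0)
    as (U & V & [_ HU] & [HV _] & U0 & HCV & HUV).
  - split.
    + replace (fun z => ~ (exists n, z = INR n + 1 + x))
        with (fun z => forall n, z <> INR n + 1 + x).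
      * apply (eta_sequence_complement (fun n => INR n + 1 + x)).
        intros n. lra.
      * apply subset_ext. intros z. split.
        -- intros H [n Hn]. now apply (H n).
        -- intros H n Hn. apply H. now exists n.
    + intros _ y Ay. pose proof (HA y Ay) as Hy.
      destruct (strip_disjoint x y Hx Hy) as [N HN]. exists N.
      intros n Hn z Hz [m ->].
      destruct (classic (x <> y \/ m <> n)) as [H | H].
      * apply (HN n Hn m (INR m + 1 + x) H); [| assumption].
        pose proof (width_pos m). lra.
      (* A strip is open, so it omits its own left endpoint. *)
      * assert (x = y) by tauto. assert (m = n) by lia. subst.
        destruct Hz. lra.
  - intros [n Hn]. pose proof (pos_INR n). lra.
  - destruct (HU U0 x Ax) as [N HN].
    destruct (HV (INR N + 1 + x)) as [e [e0 He]]; [apply HCV; now exists N |].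
    pose proof (width_pos N).
    pose proof (Rmin_l e (width N)). pose proof (Rmin_r e (width N)).
    assert (0 < Rmin e (width N)) by now apply Rmin_glb_lt.
    (* A point just right of the left endpoint lies in the strip, hence in [U], and near the
       endpoint, hence in [V]. *)
    apply (HUV (INR N + 1 + x + Rmin e (width N) / 2)). split.
    + apply (HN N); [lia |]. split; lra.
    + apply He. apply Rabs_def1; lra.
Qed.

(* The complement of the midpoints of the strips at [x] is open exactly when
   [x] is not in the index set. *)
Lemma strip_topology_incl (A B : subsetR) :
  below_half A -> below_half B ->
  (forall U, strip_topology A U -> strip_topology B U) -> forall x, B x -> A x.
Proof.
  intros HA HB HAB x Bx. apply NNPP. intros nAx.
  pose proof (HB x Bx) as Hx.
  set (mid := fun n => INR n + 1 + x + width n / 2).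
  destruct (HAB (fun z => forall n, z <> mid n)) as [_ H].
  - split.
    + apply eta_sequence_complement. intros n. unfold mid.
      pose proof (width_pos n). lra.
    + intros _ y Ay. destruct (strip_disjoint x y Hx (HA y Ay)) as [N HN].
      exists N. intros n Hn z Hz m ->.
      apply (HN n Hn m (mid m)); [| | assumption].
      * left. intros ->. contradiction.
      * unfold mid. pose proof (width_pos m). lra.
  - destruct (H) with (x := x) as [N HN]; [| assumption |].
    + intros n Hn. unfold mid in Hn. pose proof (width_pos n).
      pose proof (pos_INR n). lra.
    + apply (HN N (le_n N) (mid N)) with (n := N); [| reflexivity].
      unfold strip, mid. pose proof (width_pos N). lra.
Qed.

Lemma strip_topology_inj (A B : subsetR) :
  below_half A -> below_half B ->
  (forall U, strip_topology A U <-> strip_topology B U) -> A = B.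
Proof.
  intros HA HB H. apply subset_ext. intros x. split;
    [apply (strip_topology_incl B A) | apply (strip_topology_incl A B)];
    try assumption; intros U; apply H.
Qed.

(** * Coding sets of naturals, functions and pairs by reals *)

(** Only 0 and 2 occur, as in the Cantor set, so that distinct expansions give distinct reals. *)
Definition digit (P : nat -> Prop) (n : nat) : R :=
  if excluded_middle_informative (P n) then 2 else 0.

Fixpoint ternary_prefix (P : nat -> Prop) (n : nat) : R :=
  match n with
  | O => 0
  | S n => ternary_prefix P n + digit P n * (/ 3) ^ S n
  end.

Lemma ternary_prefix_bounds (P : nat -> Prop) (n k : nat) :
  ternary_prefix P n <= ternary_prefix P (n + k)
    <= ternary_prefix P n + (/ 3) ^ n - (/ 3) ^ (n + k).
Proof.
  induction k as [|k IH].
  - rewrite Nat.add_0_r. lra.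
  - rewrite Nat.add_succ_r. simpl.
    assert (0 < (/ 3) ^ (n + k)) by (apply pow_lt; lra).
    unfold digit. destruct (excluded_middle_informative (P (n + k)%nat)); lra.
Qed.

Lemma ternary_prefix_ext (P Q : nat -> Prop) (n : nat) :
  (forall i, (i < n)%nat -> P i <-> Q i) -> ternary_prefix P n = ternary_prefix Q n.
Proof.
  induction n as [|n IH]; intros H; [reflexivity |]. simpl.
  rewrite IH by (intros i Hi; apply H; lia). f_equal. f_equal.
  specialize (H n (Nat.lt_succ_diag_r n)). unfold digit.
  destruct (excluded_middle_informative (P n)), (excluded_middle_informative (Q n));
    tauto.
Qed.

Lemma exists_ternary : exists t : (nat -> Prop) -> R,
  forall P n, ternary_prefix P n <= t P <= ternary_prefix P n + (/ 3) ^ n.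
Proof.
  apply (choice _ _ (fun (P : nat -> Prop) r =>
    forall n, ternary_prefix P n <= r <= ternary_prefix P n + (/ 3) ^ n)).
  intros P. apply nested_intervals.
  - intros n. assert (0 < (/ 3) ^ n) by (apply pow_lt; lra). lra.
  - intros n. rewrite <- Nat.add_1_r. apply ternary_prefix_bounds.
  - intros n. rewrite <- Nat.add_1_r.
    pose proof (ternary_prefix_bounds P n 1). lra.
Qed.

Lemma exists_powerset_nat_injection : exists t : (nat -> Prop) -> R,
  (forall P, 0 <= t P <= 1) /\
  (forall P Q, t P = t Q -> forall n, P n <-> Q n).
Proof.
  destruct exists_ternary as [t Ht]. exists t. split.
  - intros P. specialize (Ht P 0%nat). simpl in Ht. lra.
  - assert (Hlt : forall P Q n, (forall i, (i < n)%nat -> P i <-> Q i) ->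
              t P = t Q -> P n -> Q n).
    (* With a common prefix s before the first difference, [t P] is at least s + 2/3^(n+1) but [t Q]
       is at most s + 1/3^(n+1). *)
    { intros P Q n Hpre Heq Pn. apply NNPP. intros nQn.
      pose proof (Ht P (S n)) as HP. pose proof (Ht Q (S n)) as HQ.
      cbn [ternary_prefix] in HP, HQ.
      rewrite (ternary_prefix_ext P Q n Hpre) in HP.
      assert (0 < (/ 3) ^ S n) by (apply pow_lt; lra).
      unfold digit in HP, HQ.
      destruct (excluded_middle_informative (P n)); [| tauto].
      destruct (excluded_middle_informative (Q n)); [tauto |]. lra. }
    intros P Q Heq n. induction n as [n IH] using (well_founded_induction Nat.lt_wf_0).
    split; apply Hlt; auto. intros i Hi. symmetry. now apply IH.
Qed.

Definition rational (n : nat) : R :=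
  let (a, m) := of_nat n in
  let (b, c) := of_nat m in (INR a - INR b) / (INR c + 1).

Lemma rational_dense (x y : R) : x < y -> exists n, x < rational n < y.
Proof.
  intros Hxy. destruct (INR_unbounded (/ (y - x))) as [c Hc].
  set (k := INR c + 1).
  assert (Hinv : 0 < / (y - x)) by (apply Rinv_0_lt_compat; lra).
  assert (Hk : 0 < k) by (unfold k; lra).
  assert (Hk1 : 1 < k * (y - x)).
  { rewrite <- (Rinv_l (y - x)) by lra. apply Rmult_lt_compat_r; unfold k; lra. }
  destruct (archimed (x * k)) as [H1 H2].
  set (z := up (x * k)) in *.
  (* [Z.to_nat] sends negative integers to 0, so the two numerators are the positive and negative
     parts of [z]. *)
  exists (to_nat (Z.to_nat z, to_nat (Z.to_nat (- z), c))).
  unfold rational. rewrite !cancel_of_to. fold k.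
  replace (INR (Z.to_nat z) - INR (Z.to_nat (- z))) with (IZR z).
  - split.
    + apply (Rmult_lt_reg_r k); [assumption |]. unfold Rdiv.
      rewrite Rmult_assoc, Rinv_l; lra.
    + apply (Rmult_lt_reg_r k); [assumption |]. unfold Rdiv.
      rewrite Rmult_assoc, Rinv_l; lra.
  - rewrite !INR_IZR_INZ, <- minus_IZR. f_equal. lia.
Qed.

(** The code records, for each rational argument, the rational cut of the value there. *)
Lemma exists_function_code : exists code : (R -> R) -> R,
  (forall f, 0 <= code f <= 1) /\
  (forall f g, code f = code g -> forall i, f (rational i) = g (rational i)).
Proof.
  destruct exists_powerset_nat_injection as [t [Ht Htinj]].
  set (graph := fun (f : R -> R) n =>
    let (i, j) := of_nat n in f (rational i) < rational j).
  exists (fun f => t (graph f)). split; [intros f; apply Ht |].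
  intros f g Hfg i.
  assert (H : forall j, f (rational i) < rational j <-> g (rational i) < rational j).
  { intros j. pose proof (Htinj _ _ Hfg (to_nat (i, j))) as H.
    unfold graph in H. now rewrite cancel_of_to in H. }
  destruct (Rtotal_order (f (rational i)) (g (rational i))) as [Hlt | [Heq | Hlt]];
    [| assumption |];
    destruct (rational_dense _ _ Hlt) as [j Hj]; specialize (H j); lra.
Qed.

(** A pair is coded as a step function jumping at 0, read back at one rational on each side. *)
Lemma exists_pairing : exists pair : R -> R -> R,
  (forall a b, 0 <= pair a b <= 1) /\
  (forall a b a' b', pair a b = pair a' b' -> a = a' /\ b = b').
Proof.
  destruct exists_function_code as [code [Hcode Hinj]].
  exists (fun a b => code (fun x => if Rlt_dec x 0 then a else b)).
  split; [intros a b; apply Hcode |].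
  intros a b a' b' H. pose proof (Hinj _ _ H) as Heq. simpl in Heq.
  destruct (rational_dense (-1) 0) as [i Hi]; [lra |].
  destruct (rational_dense 0 1) as [j Hj]; [lra |].
  pose proof (Heq i) as Hi'. pose proof (Heq j) as Hj'.
  destruct (Rlt_dec (rational i) 0); [| lra].
  destruct (Rlt_dec (rational j) 0); [lra |]. now split.
Qed.

(** * Homeomorphisms and their determination by rational values *)

(** Unlike [homeomorphic], this exposes the map, which is what gets coded. *)
Definition homeomorphism (tau1 tau2 : topR) (f : R -> R) : Prop :=
  exists g : R -> R,
    (forall x, g (f x) = x) /\ (forall y, f (g y) = y) /\
    (forall V, tau2 V -> tau1 (fun x => V (f x))) /\
    (forall U, tau1 U -> tau2 (fun y => U (g y))).

Lemma homeomorphic_sym (s t : topR) : homeomorphic s t -> homeomorphic t s.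
Proof. intros (f & g & H). exists g, f. tauto. Qed.

Lemma homeomorphic_trans (s t u : topR) :
  homeomorphic s t -> homeomorphic t u -> homeomorphic s u.
Proof.
  intros (f & g & H1 & H2 & H3 & H4) (f' & g' & H1' & H2' & H3' & H4').
  exists (fun x => f' (f x)), (fun y => g (g' y)).
  split; [| split; [| split]].
  - intros x. now rewrite H1'.
  - intros y. now rewrite H2.
  - intros V HV. apply (H3 (fun x => V (f' x))), H3', HV.
  - intros U HU. apply (H4' (fun y => U (g y))), H4, HU.
Qed.

(** The source and the bijection fix the target: its open sets are those with open preimage under
    [f]. *)
Lemma homeomorphism_target (s t t' : topR) (f : R -> R) :
  homeomorphism s t f -> homeomorphism s t' f -> forall U, t U -> t' U.
Proof.
  intros (g & _ & _ & Hc & _) (g' & _ & Hfg' & _ & Ho') U HU.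
  replace U with (fun y => U (f (g' y))).
  - apply (Ho' (fun x => U (f x))), Hc, HU.
  - apply subset_ext. intros y. now rewrite Hfg'.
Qed.

Lemma continuous_determined (f f' : R -> R) :
  (forall V, strip_topology (fun _ => True) V -> eta (fun x => V (f x))) ->
  (forall V, strip_topology (fun _ => True) V -> eta (fun x => V (f' x))) ->
  (forall i, f (rational i) = f' (rational i)) -> f = f'.
Proof.
  intros Hf Hf' Heq. apply functional_extensionality. intros x.
  apply NNPP. intros Hne.
  destruct (strip_topology_full_hausdorff _ _ Hne) as (U & V & HU & HV & Ux & Vx & HUV).
  destruct (eta_inter _ _ (Hf U HU) (Hf' V HV) x) as [e [e0 He]]; [tauto |].
  destruct (rational_dense x (x + e)) as [i Hi]; [lra |].
  destruct (He (rational i)) as [H1 H2]; [apply Rabs_def1; lra |].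
  rewrite <- Heq in H2. now apply (HUV (f (rational i))).
Qed.

(** Both maps are continuous from [eta] to the coarsest strip topology, so different targets [B] and
    [B'] do no harm. *)
Lemma strip_homeomorphism_determined (A B B' : subsetR) (f f' : R -> R) :
  homeomorphism (strip_topology A) (strip_topology B) f ->
  homeomorphism (strip_topology A) (strip_topology B') f' ->
  (forall i, f (rational i) = f' (rational i)) -> f = f'.
Proof.
  intros (g & _ & _ & Hc & _) (g' & _ & _ & Hc' & _).
  apply continuous_determined; intros V HV.
  - apply (Hc V). now apply (strip_topology_antimono B (fun _ => True)).
  - apply (Hc' V). now apply (strip_topology_antimono B' (fun _ => True)).
Qed.

(** * The diagonal argument and the final family *)

Lemma exists_class_representative (K : Type) (E : K -> K -> Prop) :
  (forall k, E k k) -> (forall k l, E k l -> E l k) ->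
  (forall k l m, E k l -> E l m -> E k m) ->
  exists rep : K -> K,
    (forall k, E (rep k) k) /\ (forall k l, E k l -> rep k = rep l).
Proof.
  intros Hrefl Hsym Htrans.
  destruct (classic (inhabited K)) as [HK | HK].
  - exists (fun k => epsilon HK (fun m => E m k)). split.
    + intros k. apply epsilon_spec. now exists k.
    (* Equivalent elements define equal predicates, on which [epsilon] makes the same choice. *)
    + intros k l Hkl. f_equal. apply functional_extensionality. intros m.
      apply propositional_extensionality. split; intros Hm; eauto.
  - exists (fun k => k). split; [assumption |]. intros k.
    destruct HK. now constructor.
Qed.

(* [C k r l] reads: the member [l] of the class of [k] carries the code [r].
   If every [r] had a value [g r] taken at [r] by no function coded by [r]
   relative to its representative, then [g] could carry no code. *)
Lemma koenig_inequivalent_family (I X : Type)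
    (E : (I -> X) -> (I -> X) -> Prop) (C : (I -> X) -> I -> (I -> X) -> Prop) :
  (forall k, E k k) -> (forall k l, E k l -> E l k) ->
  (forall k l m, E k l -> E l m -> E k m) ->
  (forall k l, E k l -> exists r, C k r l) ->
  (forall k r l l', C k r l -> C k r l' -> l = l') ->
  exists s : X -> I -> X, forall b b', E (s b) (s b') -> b = b'.
Proof.
  intros Hrefl Hsym Htrans HC Huniq.
  destruct (exists_class_representative _ E Hrefl Hsym Htrans) as [rep [Hrep Heq]].
  assert (Hr : exists r, forall b, exists k, C (rep k) r k /\ k r = b).
  { apply NNPP. intros H.
    destruct (choice _ _ (fun r b => ~ exists k, C (rep k) r k /\ k r = b)) as [g Hg].
    - intros r. apply NNPP. intros Hr. apply H. exists r. intros b.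
      apply NNPP. intros Hb. apply Hr. now exists b.
    - destruct (HC _ _ (Hrep g)) as [r Hr]. apply (Hg r). now exists g. }
  destruct Hr as [r Hr].
  destruct (choice _ _ _ Hr) as [s Hs]. exists s. intros b b' HE.
  destruct (Hs b) as [H1 H2]. destruct (Hs b') as [H1' H2'].
  (* With a shared representative, [s b] and [s b'] both carry the code [r], so they coincide, and
     so do their values at [r]. *)
  rewrite <- (Heq _ _ HE) in H1'.
  rewrite <- H2, <- H2'. now rewrite (Huniq _ _ _ _ H1 H1').
Qed.

(* 2^c many: a family indexed injectively by the power set of R *)
Theorem theorem2 :
  exists T : (R -> Prop) -> topR,
    (forall A, in_L (T A) /\ baire (T A) /\ ~ regular (T A)) /\
    (forall A B, A <> B -> ~ homeomorphic (T A) (T B)).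
Proof.
  destruct exists_pairing as [pair [Hpair Hpinj]].
  destruct exists_function_code as [code [_ Hcode]].
  (* Scaling by 1/3 places the coded pairs in [0, 1/3]. The extra point 1/2 lies apart from them and
     makes every index set nonempty, as non-regularity requires. *)
  set (idx := fun (k : R -> R -> Prop) x =>
    x = / 2 \/ exists a b, x = pair a b / 3 /\ k a b).
  assert (Hhalf : forall k, below_half (idx k)).
  { intros k x [-> | (a & b & -> & _)]; [lra |]. specialize (Hpair a b). lra. }
  assert (Hidx : forall k k' a b, idx k = idx k' -> k a b -> k' a b).
  { intros k k' a b Heq Hk.
    assert (H : idx k' (pair a b / 3)).
    { rewrite <- Heq. right. exists a, b. now split. }
    destruct H as [H | (a' & b' & H & Hk')].
    - specialize (Hpair a b). lra.
    - destruct (Hpinj a b a' b') as [-> ->]; [lra | assumption]. }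
  set (top := fun k => strip_topology (idx k)).
  destruct (koenig_inequivalent_family R (R -> Prop)
    (fun k l => homeomorphic (top k) (top l))
    (fun k r l => exists f, homeomorphism (top k) (top l) f /\ code f = r))
    as [s Hs].
  - intros k. exists (fun x => x), (fun x => x). auto.
  - intros k l. apply homeomorphic_sym.
  - intros k l m. apply homeomorphic_trans.
  - intros k l [f Hf]. now exists (code f), f.
  - intros k r l l' [f [Hf <-]] [f' [Hf' Hff']].
    assert (f' = f) as ->.
    { apply (strip_homeomorphism_determined (idx k) (idx l') (idx l));
        [assumption.. |]. now apply Hcode. }
    assert (Heq : idx l = idx l').
    { apply strip_topology_inj; [apply Hhalf.. |]. intros U. split;
        apply (homeomorphism_target (top k)) with f; assumption. }
    apply functional_extensionality. intros a. apply subset_ext. intros b.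
    split; now apply Hidx.
  - exists (fun A => top (s A)). split.
    + intros A. split; [apply strip_topology_in_L | split].
      * apply strip_topology_baire.
      * apply (strip_topology_not_regular _ (/ 2)); [apply Hhalf | now left].
    + intros A B HAB HE. now apply HAB, Hs.
Qed.
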